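(* Let $\Sigma$ be a finite alphabet, and let $p$ and $q$ be distinct words on $\Sigma$ of equal length. Suppose that the set of proper borders of $p$ is equal to the set of proper borders of $q$. Then for every $n \in \mathbb{N}$, the map $\phi_L$ (defined below) is a bijection from $A_n(p)$ to $A_n(q)$.
   Context: $\mathbb{N}$ denotes the non-negative integers. For a word $p$ on $\Sigma$, $A_n(p)$ is the set of words of length $n$ on $\Sigma$ that avoid $p$, i.e. that do not contain $p$ as a contiguous factor. A non-empty word $x$ is a border of $p$ if $x$ is both a prefix and a suffix of $p$; it is a proper border if in addition $x \neq p$. The single scan function $L$ acts on a word by replacing the leftmost (contiguous) occurrence of $q$ with $p$; if the word contains no occurrence of $q$, $L$ acts as the identity. For $w \in A_n(p)$, $\phi_L(w) = L^{i}(w)$, where $L^i$ denotes $i$-fold iteration and $i$ is the least non-negative integer such that $L^{i}(w)$ contains no occurrence of $q$ (such an $i$ always exists and $\phi_L(w)\in A_n(q)$). *)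

(* Defs.v *)
From mathcomp Require Import all_boot.

Set Implicit Arguments.
Unset Strict Implicit.
Unset Printing Implicit Defensive.

Definition avoiders (Sigma : finType) (n : nat) (p : seq Sigma) :
  {set n.-tuple Sigma} := [set w : n.-tuple Sigma | ~~ infix p w].

Definition border (Sigma : finType) (p x : seq Sigma) : Prop :=
  [/\ x <> [::], prefix x p & suffix x p].

Definition proper_border (Sigma : finType) (p x : seq Sigma) : Prop :=
  border p x /\ x <> p.

(* The single scan function L: [infix_index q w] is the starting position of
   the leftmost occurrence of q in w. *)
Definition scan (Sigma : finType) (p q w : seq Sigma) : seq Sigma :=
  if infix q w then
    let i := infix_index q w in
    take i w ++ p ++ drop (i + size q) w
  else w.

(* Termination of the iterated scan. For a letter a such that p and q first
   differ at a position where q has the letter a, each effective scan decreases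
   the binary number [weight a w] whose digits mark the occurrences of a. *)
Fixpoint weight (Sigma : finType) (a : Sigma) (w : seq Sigma) : nat :=
  if w is x :: s then (x == a) * 2 ^ size s + weight a s else 0.

Lemma weight_lt (Sigma : finType) (a : Sigma) (w : seq Sigma) :
  weight a w < 2 ^ size w.
Proof.
elim: w => [|x s IH] //=; rewrite expnS mul2n -addnn -addnS leq_add //.
by case: (x == a); rewrite ?mul1n.
Qed.

Lemma weight_cat (Sigma : finType) (a : Sigma) (u v : seq Sigma) :
  weight a (u ++ v) = weight a u * 2 ^ size v + weight a v.
Proof.
by elim: u => [|x s IH] //=; rewrite IH size_cat expnD mulnDl mulnA addnA.
Qed.

Lemma weight_sep (Sigma : finType) (p q : seq Sigma) :
  p <> q -> size p = size q -> exists a, weight a p < weight a q.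
Proof.
elim: p q => [|x p IH] [|y q] //= neq_pq [eq_sz].
have [eq_xy | neq_xy] := eqVneq x y.
  have [|a lt_a] := IH q _ eq_sz; first by move=> eq_pq; case: neq_pq; congr cons.
  by exists a; rewrite eq_xy eq_sz ltn_add2l.
exists y; rewrite (negPf neq_xy) eqxx mul0n mul1n add0n -eq_sz.
by apply: leq_trans (leq_addr _ _); apply: weight_lt.
Qed.

Lemma scan_split (Sigma : finType) (q w : seq Sigma) : infix q w ->
  w = take (infix_index q w) w ++ q ++ drop (infix_index q w + size q) w.
Proof.
rewrite infixE => /eqP eq_q; rewrite -{1}(cat_take_drop (infix_index q w) w).
congr cat; rewrite -{1}(cat_take_drop (size q) (drop _ w)) eq_q drop_drop.
by rewrite addnC.
Qed.

Lemma size_scan (Sigma : finType) (p q w : seq Sigma) :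
  size p = size q -> size (scan p q w) = size w.
Proof.
move=> eq_sz; rewrite /scan; case: ifP => //= q_in_w.
by rewrite [in RHS](scan_split q_in_w) !size_cat eq_sz.
Qed.

Lemma size_iter_scan (Sigma : finType) (p q w : seq Sigma) (i : nat) :
  size p = size q -> size (iter i (scan p q) w) = size w.
Proof. by move=> eq_sz; elim: i => //= i <-; rewrite size_scan. Qed.

Lemma scan_terminates (Sigma : finType) (p q : seq Sigma) :
  p <> q -> size p = size q ->
  forall w, exists i, ~~ infix q (iter i (scan p q) w).
Proof.
move=> neq_pq eq_sz w; have [a lt_a] := weight_sep neq_pq eq_sz.
have [m def_m] : {m | weight a w = m} by exists (weight a w).
elim/ltn_ind: m w def_m => m IH w def_m.
have [q_in_w | q_notin_w] := boolP (infix q w); last by exists 0.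
have [|i Hi] := IH (weight a (scan p q w)) _ _ (erefl _); last first.
  by exists i.+1; rewrite iterSr.
rewrite -def_m /scan q_in_w /= [X in _ < weight a X](scan_split q_in_w).
by rewrite !weight_cat !size_cat eq_sz ltn_add2l ltn_add2r ltn_pmul2r ?expn_gt0.
Qed.

Definition scan_steps (Sigma : finType) (p q : seq Sigma)
    (neq_pq : p <> q) (eq_sz : size p = size q) (w : seq Sigma) : nat :=
  ex_minn (scan_terminates neq_pq eq_sz w).

Definition phi_word (Sigma : finType) (p q : seq Sigma)
    (neq_pq : p <> q) (eq_sz : size p = size q) (w : seq Sigma) : seq Sigma :=
  iter (scan_steps neq_pq eq_sz w) (scan p q) w.

Lemma size_phi_word (Sigma : finType) (p q : seq Sigma)
    (neq_pq : p <> q) (eq_sz : size p = size q) (n : nat) (w : n.-tuple Sigma) :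
  size (phi_word neq_pq eq_sz w) == n.
Proof. by rewrite /phi_word size_iter_scan // size_tuple. Qed.

Lemma phi_word_avoids (Sigma : finType) (p q : seq Sigma)
    (neq_pq : p <> q) (eq_sz : size p = size q) (n : nat) (w : n.-tuple Sigma) :
  Tuple (size_phi_word neq_pq eq_sz w) \in avoiders n q.
Proof. by rewrite inE /= /phi_word /scan_steps; case: ex_minnP. Qed.

Definition phiL (Sigma : finType) (p q : seq Sigma)
    (neq_pq : p <> q) (eq_sz : size p = size q) (n : nat)
    (w : {w : n.-tuple Sigma | w \in avoiders n p}) :
    {w : n.-tuple Sigma | w \in avoiders n q} :=
  exist _ (Tuple (size_phi_word neq_pq eq_sz (val w)))
          (phi_word_avoids neq_pq eq_sz (val w)).

(* Main.v *)
Require Import Defs.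
From mathcomp Require Import all_boot.
From mathcomp Require Import zify.

Set Implicit Arguments.
Unset Strict Implicit.

(** Each effective scan can be undone by replacing the rightmost occurrence of
    [p] with [q]: starting from a word avoiding [p], the factor written by the
    latest scan is always the rightmost occurrence of [p].  For an occurrence of
    [p] further right would have to overlap the new factor along a border of
    [p]; being also a border of [q], this overlap would have made [p] occur at
    that place, or [q] occur further left, before the scan.  Hence a word
    avoiding [p] can be recovered from its image, so that the map is injective.
    Exchanging [p] and [q] gives an injection in the other direction, and
    bijectivity follows by counting. *)

(* [onth] makes both sides [None] beyond the end of a word, so an occurrence
   lies within [w] without an explicit length condition. *)
Definition occurs {T : Type} (u w : seq T) (i : nat) : Prop :=
  forall k, k < size u -> onth w (i + k) = onth u k.

(** That is, [s] is a period of [u]; for [0 < s < size u] this amounts to a proper border of length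
    [size u - s]. *)
Definition self_overlap {T : Type} (u : seq T) (s : nat) : Prop :=
  forall k, s + k < size u -> onth u (s + k) = onth u k.

Lemma onth_drop {T : Type} (w : seq T) (i k : nat) :
  onth (drop i w) k = onth w (i + k).
Proof. by rewrite !onthE map_drop nth_drop. Qed.

Lemma onth_take {T : Type} (w : seq T) (i k : nat) :
  k < i -> onth (take i w) k = onth w k.
Proof. by move=> lt_ki; rewrite !onthE map_take nth_take. Qed.

Lemma prefix_onthP {T : eqType} (u w : seq T) :
  prefix u w <-> occurs u w 0.
Proof.
split=> [/prefixP[v ->] k lt_k | occ_u].
  by rewrite add0n onth_cat lt_k.
rewrite prefixE; apply/eqP/eq_from_onth => k.
have [lt_k | le_k] := ltnP k (size u); first by rewrite onth_take // -occ_u.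
by rewrite !onth_default // size_take; case: ifP => // lt_s; lia.
Qed.

Lemma occursE {T : eqType} (u w : seq T) (i : nat) :
  occurs u w i <-> prefix u (drop i w).
Proof.
by rewrite prefix_onthP; split=> H k lt_k; move: (H k lt_k); rewrite onth_drop.
Qed.

Lemma infix_index_occurs {T : eqType} (u w : seq T) :
  infix u w -> occurs u w (infix_index u w).
Proof. by rewrite occursE infixE prefixE. Qed.

Lemma occurs_infix {T : eqType} (u w : seq T) (i : nat) :
  occurs u w i -> infix u w.
Proof.
move/occursE/prefixP => [v def_v]; apply/infixP; exists (take i w), v.
by rewrite -def_v cat_take_drop.
Qed.

Lemma infix_index_leftmost {T : eqType} (u w : seq T) (i : nat) :
  occurs u w i -> infix_index u w <= i.
Proof.
move/occursE; elim: w i => [|x w IH] i; first by case: u.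
case: i => [|i] /=; first by move=> ->.
by move=> /IH le_i; case: ifP.
Qed.

Section SameBorders.

Variables (Sigma : finType) (p q : seq Sigma).
Hypotheses (neq_pq : p <> q) (eq_sz : size p = size q).
Hypothesis same_borders : forall x, proper_border p x <-> proper_border q x.

(** The overlap is a proper border of [p], hence a border of [q], so [p] and [q] share this prefix
    and this suffix. *)
Lemma self_overlap_agree (s : nat) : 0 < s -> self_overlap p s ->
  forall k, s + k < size p ->
    onth q k = onth p k /\ onth q (s + k) = onth p (s + k).
Proof.
move=> s_gt0 ov k lt_k; pose x := take (size p - s) p.
have sz_x : size x = size p - s by rewrite size_take; case: ifP => //; lia.
have xE : x = drop s p.
  apply: eq_from_onth => r; rewrite onth_drop.
  have [lt_r | le_r] := ltnP r (size p - s).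
    by rewrite onth_take // ov //; lia.
  by rewrite !onth_default ?sz_x //; lia.
have /same_borders[[_ pre_x suf_x] _] : proper_border p x.
  split; last by move/(congr1 size); rewrite sz_x; lia.
  split; [by move/(congr1 size); rewrite sz_x /=; lia | exact: prefix_take |].
  by rewrite xE suffix_drop.
have xk : onth x k = onth p k by rewrite onth_take //; lia.
move: pre_x suf_x; rewrite prefixE suffixE sz_x => /eqP pre_x /eqP suf_x.
split; first by rewrite -xk -pre_x onth_take //; lia.
rewrite ov // -xk -suf_x onth_drop -eq_sz; congr onth; lia.
Qed.

Lemma onth_scan_in (w : seq Sigma) (k : nat) : infix q w -> k < size p ->
  onth (scan p q w) (infix_index q w + k) = onth p k.
Proof.
move=> q_in lt_k; have le_i : infix_index q w <= size w by rewrite infixTindex.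
rewrite /scan q_in !onth_cat size_takel //.
by rewrite ltnNge leq_addr /= addKn lt_k.
Qed.

Lemma onth_scan_out (w : seq Sigma) (k : nat) : infix q w ->
  (k < infix_index q w) || (infix_index q w + size p <= k) ->
  onth (scan p q w) k = onth w k.
Proof.
move=> q_in; have le_i : infix_index q w <= size w by rewrite infixTindex.
rewrite /scan q_in !onth_cat size_takel //.
have [lt_k _ | le_k /= le_k'] := ltnP k (infix_index q w).
  by rewrite onth_take.
rewrite ltnNge leq_subRL // le_k' /= onth_drop; congr onth; lia.
Qed.

Definition rightmost (w : seq Sigma) (i : nat) : Prop :=
  occurs p w i /\ forall k, occurs p w k -> k <= i.

Lemma scan_occurs (w : seq Sigma) : infix q w ->
  occurs p (scan p q w) (infix_index q w).
Proof. by move=> q_in k lt_k; rewrite onth_scan_in. Qed.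

Lemma scan_overlap (w : seq Sigma) (k : nat) : infix q w ->
  infix_index q w < k -> occurs p (scan p q w) k ->
  self_overlap p (k - infix_index q w).
Proof.
move=> q_in lt_jk occ_k r lt_r; rewrite -(occ_k r); last by lia.
by rewrite -(onth_scan_in q_in lt_r); congr onth; lia.
Qed.

(** Past the written factor nothing has changed. Inside it, the occurrence at [k] covers a suffix of
    [p] that is a border, where the erased [q] had the same letters. *)
Lemma occurs_before_scan (w : seq Sigma) (k : nat) : infix q w ->
  infix_index q w < k -> occurs p (scan p q w) k -> occurs p w k.
Proof.
move=> q_in lt_jk occ_k r lt_r; set j := infix_index q w in lt_jk *.
have [le_j | lt_j] := leqP (j + size p) (k + r).
  by rewrite -occ_k // onth_scan_out // le_j orbT.
have def_kr : k + r = j + (k - j + r) by lia.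
have lt_kr : k - j + r < size p by lia.
have ov := scan_overlap q_in lt_jk occ_k.
rewrite def_kr (infix_index_occurs q_in) -?eq_sz //.
have [|_ ->] := self_overlap_agree _ ov lt_kr; first by rewrite subn_gt0.
exact: ov.
Qed.

Lemma rightmost_first_scan (w : seq Sigma) : ~~ infix p w -> infix q w ->
  rightmost (scan p q w) (infix_index q w).
Proof.
move=> p_notin q_in; split=> [|k occ_k]; first exact: scan_occurs.
rewrite leqNgt; apply/negP => lt_jk.
by rewrite (occurs_infix (occurs_before_scan q_in lt_jk occ_k)) in p_notin.
Qed.

(** Suppose [p] occurs at [k] to the right of the second scan, made at [j]. It was there before that
    scan, so [j < k <= i], with [i] the place of the first. Then [q] already occurs at [j] in [w],
    although [i] is its leftmost place. *)
Lemma rightmost_next_scan (w : seq Sigma) :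
  infix q w -> infix q (scan p q w) ->
  rightmost (scan p q w) (infix_index q w) ->
  rightmost (scan p q (scan p q w)) (infix_index q (scan p q w)).
Proof.
move=> q_in q_in' [_ last_i].
split=> [|k occ_k]; first exact: scan_occurs.
rewrite leqNgt; apply/negP => lt_jk.
have le_ki := last_i k (occurs_before_scan q_in' lt_jk occ_k).
have occ_j := infix_index_occurs q_in'.
have ov_jk := scan_overlap q_in' lt_jk occ_k.
set i := infix_index q w in last_i le_ki *.
set j := infix_index q (scan p q w) in lt_jk occ_j ov_jk *.
(* [p] and [q] agree from [k - j] on; as [k <= i], this includes the part of [q] beyond [i]. *)
have agree_jk := self_overlap_agree _ ov_jk.
(* The part of [q] at [j] that lies beyond [i] is at once a prefix of the [p]
   at [i] and a suffix of [p], hence also a prefix of [q]: the first scan has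
   not destroyed any letter of the [q] at [j]. *)
have ov_ji : self_overlap p (i - j).
  move=> r lt_r.
  have def_r : i - j + r = k - j + (i - k + r) by lia.
  have [||_ agree_r] := agree_jk _ (i - k + r); [by lia | by lia |].
  rewrite {1}def_r -agree_r -def_r -occ_j -?eq_sz //.
  rewrite -(onth_scan_in q_in (k := r)); last by lia.
  by congr onth; lia.
have : i <= j; last by lia.
apply: infix_index_leftmost => r; rewrite -eq_sz => lt_r.
have [lt_i | le_i] := ltnP (j + r) i.
  by rewrite -onth_scan_out ?lt_i // occ_j -?eq_sz.
have lt_i' : j + r - i < size p by lia.
have def_jr : j + r = i + (j + r - i) by lia.
rewrite -occ_j -?eq_sz // def_jr onth_scan_in // infix_index_occurs -?eq_sz //.
by have [||-> _] := self_overlap_agree _ ov_ji (k := j + r - i); [lia | lia |].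
Qed.

Lemma rightmost_iter_scan (w : seq Sigma) (s : nat) : ~~ infix p w ->
  (forall r, r <= s -> infix q (iter r (scan p q) w)) ->
  rightmost (iter s.+1 (scan p q) w) (infix_index q (iter s (scan p q) w)).
Proof.
move=> p_notin; elim: s => [|s IH] q_in.
  exact: rightmost_first_scan p_notin (q_in 0 _).
apply: rightmost_next_scan; [exact: q_in | exact: q_in (leqnn _) |].
by apply: IH => r le_r; apply: q_in; apply: leqW.
Qed.

(** The common image determines the place of the scan; both words read [q] there and coincide with
    the image elsewhere. *)
Lemma scan_rightmost_inj (v w : seq Sigma) : infix q v -> infix q w ->
  rightmost (scan p q v) (infix_index q v) ->
  rightmost (scan p q w) (infix_index q w) ->
  scan p q v = scan p q w -> v = w.
Proof.
move=> qv qw [occ_v last_v] [occ_w last_w] eq_vw.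
have eq_i : infix_index q v = infix_index q w.
  by apply/eqP; rewrite eqn_leq last_w -?eq_vw // last_v // eq_vw.
apply: eq_from_onth => k.
have [in_k | out_k] := boolP (infix_index q v <= k < infix_index q v + size p).
  have def_k : k = infix_index q v + (k - infix_index q v) by lia.
  rewrite def_k (infix_index_occurs qv) -?eq_sz; last by lia.
  by rewrite eq_i (infix_index_occurs qw) -?eq_sz; last by lia.
rewrite -(onth_scan_out qv); last by lia.
by rewrite eq_vw onth_scan_out // -eq_i; lia.
Qed.

Lemma iter_scan_inj (v w : seq Sigma) (s t : nat) :
  ~~ infix p v -> ~~ infix p w ->
  (forall r, r < s -> infix q (iter r (scan p q) v)) ->
  (forall r, r < t -> infix q (iter r (scan p q) w)) ->
  iter s (scan p q) v = iter t (scan p q) w -> v = w.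
Proof.
move=> pv pw; elim: s t => [|s IH] [|t] qv qw eq_vw //.
(* The two numbers of scans must agree: a scanned word contains [p], whereas the starting words
   avoid it. *)
- have [/occurs_infix] := rightmost_iter_scan pw qw.
  by rewrite -eq_vw (negPf pv).
- have [/occurs_infix] := rightmost_iter_scan pv qv.
  by rewrite eq_vw (negPf pw).
have Rv := rightmost_iter_scan pv qv; have Rw := rightmost_iter_scan pw qw.
apply: (IH t) => [r lt_r | r lt_r |].
- by apply: qv; apply: ltnW.
- by apply: qw; apply: ltnW.
exact: scan_rightmost_inj (qv s _) (qw t _) Rv Rw eq_vw.
Qed.

Lemma phiL_inj (n : nat) : injective (phiL neq_pq eq_sz (n := n)).
Proof.
move=> [v Hv] [w Hw] /(congr1 val) /(congr1 val) /= eq_vw.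
apply: val_inj; apply: val_inj => /=; move: Hv Hw eq_vw; rewrite !inE => pv pw.
(* By minimality of [scan_steps], every scan counted actually replaces a [q]. *)
have before u : forall r, r < scan_steps neq_pq eq_sz u ->
    infix q (iter r (scan p q) u).
  rewrite /scan_steps; case: ex_minnP => m _ min_m r lt_r.
  by apply: contraLR lt_r => /min_m; rewrite -leqNgt.
exact: iter_scan_inj (before _) (before _).
Qed.

End SameBorders.

Theorem theorem1 (Sigma : finType) (p q : seq Sigma)
  (neq_pq : p <> q) (eq_sz : size p = size q)
  (same_borders : forall x : seq Sigma, proper_border p x <-> proper_border q x)
  (n : nat) :
  bijective (phiL neq_pq eq_sz (n := n)).
Proof.
apply: inj_card_bij; first exact: phiL_inj.
apply: (leq_card (@phiL _ q p (not_eq_sym neq_pq) (esym eq_sz) n)).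
by apply: phiL_inj => x; split=> /same_borders.
Qed.
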